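(* Let $K\subset\mathbb{R}^n$ be a finite set of distinct points with $\dim(\mathrm{co}[K])=n$ which admits a regular Delaunay triangulation of $\mathrm{co}[K]$ consisting of the $n$-dimensional simplices $\mathrm{co}[S_1],\ldots,\mathrm{co}[S_l]$. For $i=1,\ldots,l$ let $B(y_i;r_i)$ be the associated open ball of the Delaunay cell $\mathrm{co}[S_i]$, so that $B(y_i;r_i)\cap K=\varnothing$ and $K\cap\bar B(y_i;r_i)=S_i$; assume $K\setminus S_i\ne\varnothing$ and let $\sigma_i=\min\{|x-y_i|-r_i:\ x\in K\setminus S_i\}$. Let $f_K:K\to\mathbb{R}$ have Lipschitz constant $L>0$ and satisfy $|f_K(x)|\le A_0$ for all $x\in K$, for some $A_0>0$. For $i=1,\ldots,l$ let $\ell_i:\mathbb{R}^n\to\mathbb{R}$ be the affine function with $\ell_i(x)=f_K(x)$ for $x\in S_i$ and let $C_i>0$ be a constant with $|D\ell_i(x)|\le C_iL$. Then for each $i=1,\ldots,l$ and every $x\in\mathrm{co}[S_i]$, $$C^u_\lambda(f^{-M}_K)(x)=\lambda|x-y_i|^2-\lambda r_i^2+\ell_i(x),\qquad C^l_\lambda(f^{M}_K)(x)=\lambda r_i^2-\lambda|x-y_i|^2+\ell_i(x),$$ $$A^M_\lambda(f_K)(x)=\frac{C^u_\lambda(f^{-M}_K)(x)+C^l_\lambda(f^{M}_K)(x)}{2}=\ell_i(x),$$ whenever $$\lambda>\max_{1\le i\le l}\left(\frac{2A_0}{\sigma_i(2r_i+\sigma_i)}+\frac{C_iL}{\sigma_i}\right)\qquad\text{and}\qquad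 M>\max_{1\le i\le l}\left(\lambda r_i^2+C_iLr_i+A_0+\frac{C_i^2L^2}{4\lambda}\right).$$
   Context: $\mathrm{co}[E]$ is the convex hull of a set $E$; $\mathrm{co}[g]$ is the convex envelope of a function $g:\mathbb{R}^n\to\mathbb{R}$ bounded below. For bounded $g$ and $\lambda>0$, $$C^l_\lambda(g)(x)=\mathrm{co}[\lambda|\cdot|^2+g](x)-\lambda|x|^2,\qquad C^u_\lambda(g)(x)=\lambda|x|^2-\mathrm{co}[\lambda|\cdot|^2-g](x).$$ For $M>0$, $f_K^{\pm M}$ equals $f_K$ on $K$ and $\pm M$ on $\mathbb{R}^n\setminus K$, and $A^M_\lambda(f_K)=\tfrac12\bigl(C^l_\lambda(f_K^M)+C^u_\lambda(f_K^{-M})\bigr)$. Delaunay cells: for a finite set $K\subset\mathbb{R}^n$, a subset $S\subset K$ generates a Delaunay cell $\mathrm{co}[S]$ with associated open ball $B(y;r)$ ($y\in\mathbb{R}^n$, $r>0$) if $B(y;r)\cap K=\varnothing$, $S=K\cap\partial B(y;r)$ and $\dim(\mathrm{co}[S])=n$. The centres $y$ are the vertices of the Voronoi diagram of $K$; there are finitely many cells and their union is $\mathrm{co}[K]$. A cell is regular if it is an $n$-dimensional simplex ($\#(S)=n+1$); if all Delaunay cells $\mathrm{co}[S_1],\ldots,\mathrm{co}[S_l]$ of $K$ are regular, they are said to form the regular Delaunay triangulation of $\mathrm{co}[K]$. $D\ell_i$ is the gradient of $\ell_i$. *)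

(* Defs.v *)
From HB Require Import structures.
From mathcomp Require Import all_boot all_order all_algebra.
From mathcomp Require Import all_classical all_reals all_analysis.

Set Implicit Arguments.
Unset Strict Implicit.
Unset Printing Implicit Defensive.

Import Order.TTheory GRing.Theory Num.Theory.
Import numFieldNormedType.Exports.

Local Open Scope classical_set_scope.
Local Open Scope ring_scope.

(* The canonical norm of the library on 'rV[R]_n is the sup norm, hence a
   separate Euclidean norm. *)
Definition enorm (R : realType) (n : nat) (x : 'rV[R]_n) : R :=
  Num.sqrt (\sum_(i < n) x 0 i ^+ 2).

Definition eball (R : realType) (n : nat) (y : 'rV[R]_n) (r : R) :
    set 'rV[R]_n :=
  [set x | enorm (x - y) < r].

Definition esphere (R : realType) (n : nat) (y : 'rV[R]_n) (r : R) :
    set 'rV[R]_n :=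
  [set x | enorm (x - y) = r].

Definition co (R : realType) (n : nat) (E : set 'rV[R]_n) : set 'rV[R]_n :=
  smallest (fun A : set 'rV[R]_n => convex_set A) E.

Definition affine_set (R : realType) (n : nat) (A : set 'rV[R]_n) : Prop :=
  forall (x y : 'rV[R]_n) (t : R), A x -> A y -> A (t *: x + (1 - t) *: y).

Definition aff (R : realType) (n : nat) (E : set 'rV[R]_n) : set 'rV[R]_n :=
  smallest (fun A : set 'rV[R]_n => affine_set A) E.

(* The dimension of a convex set is that of its affine hull a + V. *)
Definition has_dim (R : realType) (n : nat) (A : set 'rV[R]_n) (d : nat) :
    Prop :=
  exists (a : 'rV[R]_n) (V : {vspace 'rV[R]_n}),
    aff A = [set a + v | v in [set v | v \in V]] /\ \dim V = d.

(* The largest convex function below g; for g bounded below, the set whose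
   supremum is taken is nonempty and bounded above by g x. *)
Definition co_fun (R : realType) (n : nat) (g : 'rV[R]_n -> R)
    (x : 'rV[R]_n) : R :=
  sup [set h x | h in [set h : 'rV[R]_n -> R |
                        convex_function [set: 'rV[R]_n] h /\
                        forall z, h z <= g z]].

Definition Cl (R : realType) (n : nat) (lambda : R) (g : 'rV[R]_n -> R)
    (x : 'rV[R]_n) : R :=
  co_fun (fun z => lambda * enorm z ^+ 2 + g z) x - lambda * enorm x ^+ 2.

Definition Cu (R : realType) (n : nat) (lambda : R) (g : 'rV[R]_n -> R)
    (x : 'rV[R]_n) : R :=
  lambda * enorm x ^+ 2 - co_fun (fun z => lambda * enorm z ^+ 2 - g z) x.

Definition ext (R : realType) (n : nat) (K : set 'rV[R]_n)
    (f : 'rV[R]_n -> R) (c : R) : 'rV[R]_n -> R :=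
  patch (fun=> c) K f.

Definition A_approx (R : realType) (n : nat) (lambda M : R)
    (K : set 'rV[R]_n) (f : 'rV[R]_n -> R) (x : 'rV[R]_n) : R :=
  2^-1 * (Cl lambda (ext K f M) x + Cu lambda (ext K f (- M)) x).

Definition delaunay_cell (R : realType) (n : nat) (K S : set 'rV[R]_n)
    (y : 'rV[R]_n) (r : R) : Prop :=
  [/\ 0 < r, eball y r `&` K = set0, S = K `&` esphere y r
    & has_dim (co S) n].

(* The sets S i generate all the Delaunay cells of K, with associated balls
   B(y i; r i), and each of these cells is a simplex. *)
Definition regular_delaunay_triangulation (R : realType) (n : nat)
    (K : set 'rV[R]_n) (l : nat) (S : 'I_l -> set 'rV[R]_n)
    (y : 'I_l -> 'rV[R]_n) (r : 'I_l -> R) : Prop :=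
  [/\ forall i, delaunay_cell K (S i) (y i) (r i),
      forall i, (S i #= `I_n.+1)%card
    & forall (T : set 'rV[R]_n) (z : 'rV[R]_n) (s : R),
        delaunay_cell K T z s -> exists i, T = S i].

Definition is_min (R : realType) (A : set R) (m : R) : Prop :=
  A m /\ lbound A m.

Definition affine_fun (R : realType) (n : nat) (g : 'rV[R]_n -> R) : Prop :=
  exists (a : 'rV[R]_n) (b : R), forall x, g x = \sum_(i < n) a 0 i * x 0 i + b.

Definition grad (R : realType) (n : nat) (g : 'rV[R]_n -> R)
    (x : 'rV[R]_n) : 'rV[R]_n :=
  \row_(j < n) 'D_(delta_mx 0 j) g x.

(* Main.v *)
Require Import Defs.
From HB Require Import structures.
From mathcomp Require Import all_boot all_order all_algebra.
From mathcomp Require Import all_classical all_reals all_analysis.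
From mathcomp Require Import ring lra.

Set Implicit Arguments.
Unset Strict Implicit.
Unset Printing Implicit Defensive.

Import Order.TTheory GRing.Theory Num.Theory.
Import numFieldNormedType.Exports.

Local Open Scope classical_set_scope.
Local Open Scope ring_scope.

(** The convex envelope of [g] equals an affine function [a] on [co S] as soon
    as [a <= g] everywhere with equality on [S]: [a] itself is a convex
    minorant, and a convex minorant lies below [a] on [S], hence on [co S]
    because the set where it does so is convex ([co_fun_affine]).

    For the upper transform on the cell of [S = S_i] the affine function is
      [a z = lambda |z|^2 - (lambda |z - y|^2 - lambda r^2 + ell z)],
    whose quadratic terms cancel, and [g] is [lambda |z|^2] minus the extension
    of [f] by [- M].  Contact on [S] holds since [S] lies on the sphere of
    centre [y] and radius [r] and [ell] interpolates [f] there.  The inequality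
    [a <= g] says that the paraboloid [lambda |z - y|^2 - lambda r^2 + ell z]
    dominates the extension.  With [s = |z - y|] and [c = C_i L], going from [z]
    to [y] and from [y] to a vertex of the cell gives
    [ell z >= - A0 - c (r + s)], so that domination reduces to a one-variable
    quadratic inequality in [s]: at the sites outside [S], where
    [s >= r + sigma], it follows from the bound on [lambda]
    ([far_site_bound]); away from [K] it follows from the bound on [M], by
    completing the square ([off_site_bound]).

    The lower transform is the opposite of the upper transform of the opposite
    function ([ClE_Cu]), so its formula is the one for [- f] and [- ell]; the
    quadratic parts then cancel in the average. *)

(** * Euclidean geometry and affine functions *)

Section Euclidean.
Context {R : realType} {n : nat}.
Implicit Types u v x y : 'rV[R]_n.

Definition dot u v : R := \sum_(i < n) u 0 i * v 0 i.

Lemma enorm_ge0 u : 0 <= enorm u.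
Proof. exact: sqrtr_ge0. Qed.

Lemma sqr_enorm u : enorm u ^+ 2 = dot u u.
Proof.
rewrite /enorm sqr_sqrtr; last by apply: sumr_ge0 => i _; exact: sqr_ge0.
by apply: eq_bigr => i _; rewrite expr2.
Qed.

Lemma dotC u v : dot u v = dot v u.
Proof. by apply: eq_bigr => i _; rewrite mulrC. Qed.

Lemma dotDl u v w : dot (u + v) w = dot u w + dot v w.
Proof. by rewrite -big_split; apply: eq_bigr => i _; rewrite !mxE mulrDl. Qed.

Lemma dotZl t u v : dot (t *: u) v = t * dot u v.
Proof. by rewrite mulr_sumr; apply: eq_bigr => i _; rewrite !mxE mulrA. Qed.

Lemma dotDr u v w : dot u (v + w) = dot u v + dot u w.
Proof. by rewrite dotC dotDl !(dotC u). Qed.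

Lemma dotZr t u v : dot u (t *: v) = t * dot u v.
Proof. by rewrite dotC dotZl dotC. Qed.

Lemma dotBl u v w : dot (u - v) w = dot u w - dot v w.
Proof. by rewrite dotDl -scaleN1r dotZl mulN1r. Qed.

Lemma dotBr u v w : dot u (v - w) = dot u v - dot u w.
Proof. by rewrite dotC dotBl !(dotC u). Qed.

(** The squared norm of [|v|^2 u - <u, v> v] is nonnegative, and equals
    [|v|^2] times the difference of the squares of the two sides. *)
Lemma cauchy_schwarz u v : `|dot u v| <= enorm u * enorm v.
Proof.
rewrite -(@ler_pXn2r _ 2) ?nnegrE ?mulr_ge0 ?enorm_ge0// exprMn !sqr_enorm.
rewrite -normrX ger0_norm ?sqr_ge0//.
have vv_ge0 : 0 <= dot v v by rewrite -sqr_enorm sqr_ge0.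
have [vv0|vv_neq0] := eqVneq (dot v v) 0.
  suff -> : v = 0 by rewrite -(scale0r u) !(dotZr, dotZl) !mul0r expr0n mulr0.
  apply/rowP => j; rewrite mxE; apply/eqP; rewrite -sqrf_eq0 expr2; apply/eqP.
  by move/psumr_eq0P : vv0; apply => // k _; rewrite -expr2 sqr_ge0.
have vv_gt0 : 0 < dot v v by rewrite lt_neqAle eq_sym vv_neq0.
have : 0 <= dot (dot v v *: u - dot u v *: v) (dot v v *: u - dot u v *: v).
  by rewrite -sqr_enorm sqr_ge0.
rewrite !(dotBl, dotBr, dotZl, dotZr) (dotC v u) => h.
rewrite -(ler_pM2l vv_gt0) -subr_ge0; move: h.
by set a := dot u v; set b := dot v v; set c := dot u u; congr (0 <= _); ring.
Qed.

Lemma affine_funP (g : 'rV[R]_n -> R) :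
  affine_fun g <-> exists a b, forall x, g x = dot a x + b.
Proof. by []. Qed.

Lemma affine_fun_conv (g : 'rV[R]_n -> R) (t : R) u v : affine_fun g ->
  g (t *: u + (1 - t) *: v) = t * g u + (1 - t) * g v.
Proof. by case/affine_funP => a [b gE]; rewrite !gE dotDr !dotZr; ring. Qed.

Lemma affine_funN (g : 'rV[R]_n -> R) : affine_fun g -> affine_fun (\- g).
Proof.
case/affine_funP => a [b gE]; apply/affine_funP; exists (- a), (- b) => z.
by rewrite /= gE -(scaleN1r a) dotZl; ring.
Qed.

Lemma grad_affine (g : 'rV[R]_n -> R) a b x :
  (forall x, g x = dot a x + b) -> grad g x = a.
Proof.
move=> gE; apply/rowP => j; rewrite mxE /derive; apply: lim_near_cst => //.
near=> h; rewrite /= !gE dotDr dotZr.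
have -> : dot a (delta_mx 0 j) = a 0 j.
  rewrite /dot (bigD1 j)//= !mxE !eqxx mulr1 big1 ?addr0// => k /negPf kj.
  by rewrite mxE eqxx kj mulr0.
rewrite (_ : _ - _ = h * a 0 j); last by ring.
by rewrite /GRing.scale/= mulKf//; near: h; exact: nbhs_dnbhs_neq.
Unshelve. all: by end_near. Qed.

(** The gradient of an affine function is its constant linear part, so a bound
    on it is a Lipschitz constant by Cauchy-Schwarz. *)
Lemma affine_fun_lipschitz (g : 'rV[R]_n -> R) c : affine_fun g ->
  (forall x, enorm (grad g x) <= c) ->
  forall x z, `|g x - g z| <= c * enorm (x - z).
Proof.
case/affine_funP => a [b gE] gc x z.
have -> : g x - g z = dot a (x - z) by rewrite !gE dotBr; ring.
apply: le_trans (cauchy_schwarz _ _) _.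
by rewrite ler_wpM2r ?enorm_ge0// -(grad_affine x gE).
Qed.

(** * Convex envelopes and the transforms over a cell *)

(** Contact with [g] on [S] alone determines the envelope on all of [co S]. *)
Lemma co_fun_affine (a g : 'rV[R]_n -> R) (S : set 'rV[R]_n) x :
  affine_fun a -> (forall z, a z <= g z) -> (forall z, S z -> g z = a z) ->
  co S x -> co_fun g x = a x.
Proof.
move=> aff_a ag gS Sx; rewrite /co_fun; set H := [set _ | _ in _].
have Hub : ubound H (a x).
  move=> _ [h [hconv hg] <-].
  apply: (@smallest_sub _ _ S [set z | h z <= a z] _ _ x Sx).
    move=> u v t; rewrite !inE /= => hu hv.
    apply: le_trans (hconv t u v _ _) _; rewrite ?inE//.
    rewrite [leRHS](affine_fun_conv _ _ _ aff_a) lerD// ler_wpM2l//.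
    by rewrite subr_ge0.
  by move=> z /= Sz; rewrite -gS.
have Ha : H (a x).
  exists a => //; split => // t u v _ _.
  by rewrite [leLHS](affine_fun_conv _ _ _ aff_a).
apply/eqP; rewrite eq_le; apply/andP; split.
  by apply: ge_sup => //; exists (a x).
by apply: ub_le_sup => //; exists (a x).
Qed.

(** The quadratic terms [lambda |z|^2] of the two paraboloids cancel. *)
Lemma affine_fun_sub_paraboloid (ell : 'rV[R]_n -> R) (lambda c : R) y :
  affine_fun ell ->
  affine_fun (fun z => lambda * enorm z ^+ 2 -
                       (lambda * enorm (z - y) ^+ 2 - c + ell z)).
Proof.
case/affine_funP => a [b ellE]; apply/affine_funP.
exists ((2 * lambda) *: y - a), (c - lambda * dot y y - b) => z.
by rewrite ellE !sqr_enorm !(dotBl, dotBr, dotZl) (dotC z y); ring.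
Qed.

Lemma Cu_affine_cell (lambda c : R) (ell g : 'rV[R]_n -> R)
    (S : set 'rV[R]_n) y x :
  affine_fun ell ->
  (forall z, g z <= lambda * enorm (z - y) ^+ 2 - c + ell z) ->
  (forall z, S z -> g z = lambda * enorm (z - y) ^+ 2 - c + ell z) ->
  co S x -> Cu lambda g x = lambda * enorm (x - y) ^+ 2 - c + ell x.
Proof.
move=> aff_ell g_le gS Sx; rewrite /Cu.
rewrite (co_fun_affine (affine_fun_sub_paraboloid lambda c y aff_ell) _ _ Sx).
- by rewrite opprB addrC subrK.
- by move=> z; rewrite lerD2l lerN2.
- by move=> z Sz; rewrite gS.
Qed.

(** This duality transfers every statement about the upper transform to the
    lower one. *)
Lemma ClE_Cu (lambda : R) (g : 'rV[R]_n -> R) x :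
  Cl lambda g x = - Cu lambda (\- g) x.
Proof.
rewrite /Cl /Cu opprB; congr (co_fun _ x - _).
by apply/funext => z; rewrite opprK.
Qed.

Lemma extN (K : set 'rV[R]_n) (f : 'rV[R]_n -> R) (M : R) :
  \- (ext K f M) = ext K (\- f) (- M).
Proof. by apply/funext => z; rewrite /ext /patch/=; case: ifP. Qed.

End Euclidean.

(** * The thresholds on lambda and M *)

Section Thresholds.
Context {R : realFieldType}.
Implicit Types lambda c A sigma r s : R.

(** Each term of the threshold pays for one term on the left, after
    [s^2 - r^2 = (s - r) (s + r)]: the first because
    [(s - r) (s + r) >= sigma (2 r + sigma)], the second because
    [s - r >= sigma]. *)
Lemma far_site_bound lambda c A sigma r s :
  0 <= c -> 0 <= A -> 0 < r -> 0 < sigma -> r + sigma <= s ->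
  2 * A / (sigma * (2 * r + sigma)) + c / sigma < lambda ->
  2 * A + c * (r + s) <= lambda * (s ^+ 2 - r ^+ 2).
Proof.
move=> c0 A0 r0 sg0 rs lam.
have d_gt0 : 0 < sigma * (2 * r + sigma) by rewrite mulr_gt0//; lra.
have st : 0 <= s ^+ 2 - r ^+ 2 by nra.
apply: le_trans (ler_wpM2r st (ltW lam)); rewrite [leRHS]mulrDl; apply: lerD.
  rewrite mulrAC ler_pdivlMr// ler_wpM2l//; first by rewrite mulr_ge0.
  by nra.
rewrite mulrAC ler_pdivlMr// -!mulrA ler_wpM2l//.
by nra.
Qed.

(** The minimum over [s] of [lambda s^2 - c s] is [- c^2 / (4 lambda)]. *)
Lemma off_site_bound lambda c A r s : 0 < lambda ->
  - (lambda * r ^+ 2 + c * r + A + c ^+ 2 / (4 * lambda)) <=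
  lambda * s ^+ 2 - lambda * r ^+ 2 - A - c * (r + s).
Proof.
move=> lam0; rewrite -subr_ge0.
rewrite (_ : _ - _ = lambda * (s - c / (2 * lambda)) ^+ 2).
  by rewrite mulr_ge0 ?sqr_ge0 // ltW.
by field; rewrite gt_eqF.
Qed.

End Thresholds.

(** * The cell formula *)

(** Stated with a Lipschitz constant [c] of [ell] instead of a gradient bound,
    so that all hypotheses are visibly stable under [f, ell |-> - f, - ell]. *)
Lemma Cu_delaunay_cell (R : realType) (n : nat) (K S : set 'rV[R]_n)
    (y p x : 'rV[R]_n) (r sigma : R) (f ell : 'rV[R]_n -> R) (A c lambda M : R) :
  0 < r -> S = K `&` esphere y r -> S p ->
  0 < sigma -> (forall z, (K `\` S) z -> r + sigma <= enorm (z - y)) ->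
  (forall z, K z -> `|f z| <= A) ->
  affine_fun ell -> (forall z, S z -> ell z = f z) ->
  0 <= c -> (forall u v, `|ell u - ell v| <= c * enorm (u - v)) ->
  0 < lambda ->
  2 * A / (sigma * (2 * r + sigma)) + c / sigma < lambda ->
  lambda * r ^+ 2 + c * r + A + c ^+ 2 / (4 * lambda) < M ->
  co S x ->
  Cu lambda (ext K f (- M)) x
    = lambda * enorm (x - y) ^+ 2 - lambda * r ^+ 2 + ell x.
Proof.
move=> r0 SE Sp sg0 sgap fA aff_ell ell_f c0 lip lam0 lam_gt M_gt Sx.
have [Kp py] : K p /\ enorm (p - y) = r by move: Sp; rewrite SE.
have A0 : 0 <= A := le_trans (normr_ge0 _) (fA _ Kp).
(* The path from [z] to [p] through the centre [y] has length [s + r]. *)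
have ell_ge z : - A - c * (r + enorm (z - y)) <= ell z.
  have /ler_normlP[_ h1] := lip p y.
  have /ler_normlP[h2 _] := lip z y.
  have /ler_normlP[h3 _] := fA _ Kp.
  by move: h1 h2; rewrite py (ell_f _ Sp); lra.
have on_S z : S z -> ext K f (- M) z =
    lambda * enorm (z - y) ^+ 2 - lambda * r ^+ 2 + ell z.
  move=> Sz; move: (Sz); rewrite SE => -[Kz ->].
  by rewrite /ext /patch mem_set// ell_f// subrr add0r.
apply: (Cu_affine_cell aff_ell _ on_S Sx) => z.
have [Sz|nSz] := pselect (S z); first by rewrite on_S.
have ell_z := ell_ge z.
rewrite /ext /patch; case: ifPn => [|_].
  rewrite inE => Kz.
  have := far_site_bound c0 A0 r0 sg0 (sgap z (conj Kz nSz)) lam_gt.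
  have /ler_normlP[_ ?] := fA _ Kz.
  by lra.
have := off_site_bound c A r (enorm (z - y)) lam0.
by lra.
Qed.

(* In the two lower bounds on lambda and M all terms of the maxima are
   positive, so that the default value 0 of the iterated maximum is harmless. *)
Theorem corollary4p7 (R : realType) (n : nat) (K : set 'rV[R]_n)
    (finK : finite_set K) (dimK : has_dim (co K) n)
    (l : nat) (S : 'I_l -> set 'rV[R]_n) (y : 'I_l -> 'rV[R]_n) (r : 'I_l -> R)
    (triK : regular_delaunay_triangulation K S y r)
    (KS_neq0 : forall i, K `\` S i !=set0)
    (sigma : 'I_l -> R)
    (sigma_min : forall i,
      is_min [set enorm (x - y i) - r i | x in K `\` S i] (sigma i))
    (f : 'rV[R]_n -> R) (L A0 : R)
    (L_gt0 : 0 < L)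
    (f_lip : forall x z, K x -> K z -> `|f x - f z| <= L * enorm (x - z))
    (A0_gt0 : 0 < A0) (f_bnd : forall x, K x -> `|f x| <= A0)
    (ell : 'I_l -> 'rV[R]_n -> R)
    (ell_affine : forall i, affine_fun (ell i))
    (ell_interp : forall i x, S i x -> ell i x = f x)
    (C : 'I_l -> R) (C_gt0 : forall i, 0 < C i)
    (ell_grad : forall i x, enorm (grad (ell i) x) <= C i * L)
    (lambda M : R)
    (lambda_gt :
      \big[Num.max/0]_(i < l)
        (2 * A0 / (sigma i * (2 * r i + sigma i)) + C i * L / sigma i)
      < lambda)
    (M_gt :
      \big[Num.max/0]_(i < l)
        (lambda * r i ^+ 2 + C i * L * r i + A0
         + C i ^+ 2 * L ^+ 2 / (4 * lambda))
      < M)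
    (i : 'I_l) (x : 'rV[R]_n) (xS : co (S i) x) :
  [/\ Cu lambda (ext K f (- M)) x
        = lambda * enorm (x - y i) ^+ 2 - lambda * r i ^+ 2 + ell i x,
      Cl lambda (ext K f M) x
        = lambda * r i ^+ 2 - lambda * enorm (x - y i) ^+ 2 + ell i x,
      A_approx lambda M K f x
        = (Cu lambda (ext K f (- M)) x + Cl lambda (ext K f M) x) / 2
    & (Cu lambda (ext K f (- M)) x + Cl lambda (ext K f M) x) / 2 = ell i x].
Proof.
case: triK => cellS simplexS _.
have [r0 KB0 SE _] := cellS i.
have /bigmax_ltP[lam0 /(_ i isT) lam_i] := lambda_gt.
have /bigmax_ltP[_ /(_ i isT) M_i] := M_gt.
have [p Sp] : S i !=set0.
  apply/set0P/eqP => S0; have h0 : `I_n.+1 0%N by [].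
  move: (simplexS i); rewrite S0 card_eq_sym.
  by rewrite card_eq0 => /eqP/seteqP[/(_ 0%N h0) ].
have [[q [Kq nSq] qs] s_le] := sigma_min i.
(* A site outside [S i] is neither in the open ball, which misses [K], nor on
   the sphere, which meets [K] in [S i]. *)
have sg0 : 0 < sigma i.
  rewrite -qs subr_gt0 lt_neqAle; apply/andP; split.
    by apply/eqP => rq; apply: nSq; rewrite SE.
  rewrite leNgt; apply/negP => qr.
  by have : (eball (y i) (r i) `&` K) q by []; rewrite KB0.
have gap z : (K `\` S i) z -> r i + sigma i <= enorm (z - y i).
  by move=> KSz; rewrite -lerBrDl; apply: s_le; exists z.
rewrite -exprMn in M_i.
have cL_ge0 : 0 <= C i * L by rewrite mulr_ge0 ?ltW.
have lip := affine_fun_lipschitz (ell_affine i) (ell_grad i).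
have CuE : Cu lambda (ext K f (- M)) x =
    lambda * enorm (x - y i) ^+ 2 - lambda * r i ^+ 2 + ell i x.
  exact: (Cu_delaunay_cell r0 SE Sp sg0 gap f_bnd (ell_affine i)
    (@ell_interp i) cL_ge0 lip lam0 lam_i M_i xS).
have ClE : Cl lambda (ext K f M) x =
    lambda * r i ^+ 2 - lambda * enorm (x - y i) ^+ 2 + ell i x.
  rewrite ClE_Cu extN.
  rewrite (Cu_delaunay_cell r0 SE Sp sg0 gap (f := \- f) _
    (affine_funN (ell_affine i)) _ cL_ge0 _ lam0 lam_i M_i xS) /=.
  - by ring.
  - by move=> z Kz; rewrite normrN; exact: f_bnd.
  - by move=> z Sz; rewrite /= ell_interp.
  - by move=> u v; rewrite /= -opprD normrN; exact: lip.
split => //; first by rewrite /A_approx mulrC addrC.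
by rewrite CuE ClE; field.
Qed.
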